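(* The smallest integer $n\ge 2$ such that there exists a connected graph in $\mathfrak{Gr}(n,n,2)$ is $n=7$. Likewise, the smallest integer $n\ge2$ such that there exists a graph without isolated vertices in $\mathfrak{Gr}(n,n,2)$ is $n=7$.
   Context: All graphs are finite, simple and undirected. For a graph $G=(V,E)$ and $x\in V$, $N[x]=\{x\}\cup\{y: xy\in E\}$; for $X\subseteq V$, $N[X]=\bigcup_{x\in X}N[x]$ (so $N[\emptyset]=\emptyset$). A set $C\subseteq V$ is $(1,\le\ell)$-identifying if $N[X]\cap C\neq N[Y]\cap C$ for all distinct $X,Y\subseteq V$ with $|X|\le\ell$, $|Y|\le\ell$. For $n\ge k\ge1$ and $\ell\ge1$, $\mathfrak{Gr}(n,k,\ell)$ is the set of graphs on $n$ vertices in which every $k$-element subset of vertices is $(1,\le\ell)$-identifying; in particular $G\in\mathfrak{Gr}(n,n,2)$ means that the whole vertex set of $G$ is $(1,\le2)$-identifying. An isolated vertex is a vertex of degree $0$. *)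

(* Defs.v *)
From mathcomp Require Import all_boot.

Set Implicit Arguments.
Unset Strict Implicit.
Unset Printing Implicit Defensive.

Record sgraph := SGraph {
  vertex :> finType;
  edge : rel vertex;
  edge_sym : symmetric edge;
  edge_irrefl : irreflexive edge
}.

Definition closed_nbhd (G : sgraph) (x : G) : {set G} :=
  [set y | (y == x) || edge x y].

Definition closed_nbhd_set (G : sgraph) (X : {set G}) : {set G} :=
  \bigcup_(x in X) closed_nbhd x.

(* [X] and [Y] may be empty. *)
Definition identifying (G : sgraph) (l : nat) (C : {set G}) : Prop :=
  forall X Y : {set G}, X != Y -> #|X| <= l -> #|Y| <= l ->
    closed_nbhd_set X :&: C <> closed_nbhd_set Y :&: C.

(* Meaningful for [1 <= k <= n] and [1 <= l]. *)
Definition Gr (n k l : nat) (G : sgraph) : Prop :=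
  #|G| = n /\ forall C : {set G}, #|C| = k -> identifying l C.

Definition connected (G : sgraph) : Prop :=
  forall x y : G, connect (@edge G) x y.

Definition degree (G : sgraph) (x : G) : nat := #|[set y | edge x y]|.

Definition isolated (G : sgraph) (x : G) : Prop := degree x = 0.

Definition smallest_from (a : nat) (P : nat -> Prop) (m : nat) : Prop :=
  [/\ a <= m, P m & forall n, a <= n -> P n -> m <= n].

(* Main.v *)
Require Import Defs.
From mathcomp Require Import all_boot.

Set Implicit Arguments.
Unset Strict Implicit.
Unset Printing Implicit Defensive.

(** For [n <= 6], count the pairs [(v, A)] with [#|A| = 2] and [v] outside
    [N[A]].  A vertex [v] is outside [N[A]] iff [A] avoids [N[v]], and
    [#|N[v]| >= 3] when there are no isolated vertices (if [N[x]] were contained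
    in [N[y]], then [{x, y}] and [{y}] would be confused), so there are at most
    [n * 'C(n - 3, 2)] such pairs.  On the other hand the complements of the
    [N[A]] are pairwise distinct: at most one is empty and at most [n] are
    singletons, so there are at least [2 * 'C(n, 2) - n - 2] such pairs.  These
    bounds are incompatible for [3 <= n <= 6].  For [n = 7] the cycle works. *)

(** By injectivity at most ['C(#|T|, k)] of the sets [F i] have size [k]. Only singletons and the
    empty set fall short of size 2, by 1 and by 2 respectively, so the total shortfall is at most
    [#|T| + 2]. *)
Lemma sum_card_distinct_sets (I T : finType) (P : {pred I}) (F : I -> {set T}) :
  {in P &, injective F} -> 2 * #|P| <= \sum_(i in P) #|F i| + #|T| + 2.
Proof.
move=> injF.
have small k : #|[set i in P | #|F i| == k]| <= 'C(#|T|, k).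
  rewrite -card_draws -(@card_in_imset _ _ F).
    apply/subset_leq_card/subsetP=> S /imsetP[i]; rewrite !inE => /andP[_ ?].
    by move=> ->.
  by move=> i j; rewrite !inE => /andP[Pi _] /andP[Pj _]; apply: injF.
have card1 k : #|[set i in P | #|F i| == k]| = \sum_(i in P) (#|F i| == k).
  by rewrite -sum1dep_card big_mkcondr; apply: eq_bigr => i _; case: eqP.
have := leq_add (small 1) (leq_mul (leqnn 2) (small 0)).
rewrite bin1 bin0 !card1 big_distrr -big_split /= => le_small.
rewrite -addnA; apply: leq_trans (leq_add (leqnn _) le_small).
rewrite mulnC -sum_nat_const -big_split; apply: leq_sum => i _ /=.
by case: #|F i| => [|[|m]].
Qed.

Section ClosedNeighbourhoods.

Variable G : sgraph.
Implicit Types (x y v : G) (X Y A : {set G}).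

Lemma closed_nbhd_sym x y : (y \in closed_nbhd x) = (x \in closed_nbhd y).
Proof. by rewrite !inE eq_sym edge_sym. Qed.

Lemma notin_closed_nbhd_set v A :
  (v \notin closed_nbhd_set A) = (A \subset ~: closed_nbhd v).
Proof.
apply/idP/subsetP => [vNA x xA|Av].
  rewrite in_setC -closed_nbhd_sym; apply: contra vNA => vx.
  by apply/bigcupP; exists x.
apply/bigcupP=> -[x xA]; rewrite closed_nbhd_sym => xv.
by have := Av x xA; rewrite in_setC xv.
Qed.

Lemma closed_nbhd_setU X Y :
  closed_nbhd_set (X :|: Y) = closed_nbhd_set X :|: closed_nbhd_set Y.
Proof. exact: bigcup_setU. Qed.

Lemma closed_nbhd_set1 x : closed_nbhd_set [set x] = closed_nbhd x.
Proof. exact: big_set1. Qed.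

Lemma Gr_injective n l : Gr n n l G ->
  {in [pred X : {set G} | #|X| <= l] &, injective (@closed_nbhd_set G)}.
Proof.
case=> cardG idG X Y lX lY eqXY; apply/eqP/negPn/negP=> neqXY.
by apply: (idG setT) neqXY lX lY _; rewrite ?cardsT // eqXY.
Qed.

(** Double counting of the pairs [(v, A)] with [v] outside [N[A]]: for fixed [v], the suitable [A]
    are the [k]-subsets of the complement of [N[v]]. *)
Lemma sum_card_notin_closed_nbhd_set k :
  \sum_(A : {set G} | #|A| == k) #|~: closed_nbhd_set A|
    = \sum_(v : G) 'C(#|~: closed_nbhd v|, k).
Proof.
transitivity (\sum_(A : {set G} | #|A| == k) \sum_(v : G)
               (A \subset ~: closed_nbhd v)).
  apply: eq_bigr => A _; rewrite -sum1_card big_mkcond; apply: eq_bigr => v _.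
  by rewrite inE notin_closed_nbhd_set; case: ifP.
rewrite exchange_big; apply: eq_bigr => v _ /=.
rewrite -cards_draws -sum1dep_card big_mkcondl.
by apply: eq_bigr => A _; case: (_ \subset _).
Qed.

Lemma closed_nbhd_gt2 n x : Gr n n 2 G -> ~ isolated x -> 2 < #|closed_nbhd x|.
Proof.
move=> GrG /eqP; rewrite cards_eq0 => /set0Pn[y]; rewrite inE => xy.
have neq_xy : x != y by apply: contraTneq xy => ->; rewrite edge_irrefl.
have /subsetPn[z xz yz] : ~~ (closed_nbhd x \subset closed_nbhd y).
  apply/negP=> /setUidPr sub.
  suff : [set x] :|: [set y] = [set y].
    by move/setP/(_ x); rewrite !inE eqxx (negPf neq_xy).
  apply: (Gr_injective GrG); rewrite ?inE ?cards2 ?cards1 ?neq_xy //.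
  by rewrite closed_nbhd_setU !closed_nbhd_set1.
(* Both [x] and [y] lie in [N[y]], while [z] does not, so [z], [x], [y] are three distinct members
   of [N[x]]. *)
have zN w : w \in closed_nbhd y -> z != w by apply: contraTneq => <-.
rewrite (leq_trans _ (subset_leq_card (_ : [set z; x; y] \subset _))) //.
  rewrite -setUA cardsU1 cards2 neq_xy !inE negb_or !zN // !inE ?eqxx //.
  by rewrite edge_sym xy orbT.
by apply/subsetP=> w; rewrite !inE => /orP[/orP[]|] /eqP-> //;
   rewrite ?eqxx ?xy ?orbT //; rewrite inE in xz.
Qed.

Lemma Gr_no_isolated_ge7 n : 2 <= n -> Gr n n 2 G ->
  ~ (exists x, isolated x) -> 7 <= n.
Proof.
move=> n_ge2 GrG niso; have [cardG _] := GrG.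
have gt2 x : 2 < #|closed_nbhd x|.
  by apply: closed_nbhd_gt2 GrG _ => ix; apply: niso; exists x.
(* The case [n = 2] has to be excluded beforehand, since there the counting inequality reads
   [2 <= 4] and gives no contradiction. *)
have n_gt2 : 2 < n.
  have /card_gt0P[x _] : 0 < #|G| by rewrite cardG ltnW.
  by rewrite -cardG (leq_trans (gt2 x)) ?max_card.
have inj : {in [pred A : {set G} | #|A| == 2] &,
            injective (fun A => ~: closed_nbhd_set A)}.
  move=> A B /eqP A2 /eqP B2 /setC_inj.
  by apply: (Gr_injective GrG); rewrite inE ?A2 ?B2.
have := sum_card_distinct_sets inj.
have -> : #|[pred A : {set G} | #|A| == 2]| = 'C(n, 2).
  by rewrite -cardG -card_draws cardsE.
rewrite sum_card_notin_closed_nbhd_set cardG => lower.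
have upper : \sum_(v : G) 'C(#|~: closed_nbhd v|, 2) <= n * 'C(n - 3, 2).
  rewrite -cardG -sum_nat_const; apply: leq_sum => v _.
  by rewrite leq_bin2l // cardsCs setCK leq_sub2l.
have {lower upper} := leq_trans lower (leq_add (leq_add upper (leqnn n)) (leqnn 2)).
(* For [n] = 3, 4, 5, 6 the inequality would read [6 <= 5], [12 <= 6], [20 <= 12], [30 <= 26]. *)
by case: n n_gt2 {n_ge2 GrG cardG} => [|[|[|[|[|[|[|n]]]]]]].
Qed.

Lemma connected_no_isolated :
  2 <= #|G| -> connected G -> ~ (exists x : G, isolated x).
Proof.
move=> /card_gt1P[a [b [_ _ neq_ab]]] conG [x /cards0_eq x0].
have [y neq_xy] : exists y, x != y.
  by have [->|?] := eqVneq x a; [exists b | exists a].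
(* As [y] differs from [x], the path is nonempty, and its first edge gives [x] a neighbour. *)
have /connectP[[|z p] /= pth last_y] := conG x y.
  by rewrite last_y eqxx in neq_xy.
by have /setP/(_ z) := x0; rewrite !inE; case/andP: pth => ->.
Qed.

End ClosedNeighbourhoods.

Lemma set_card_le2 (T : finType) (X : {set T}) :
  #|X| <= 2 -> X = set0 \/ exists a b, X = [set a; b].
Proof.
rewrite leq_eqVlt ltnS leq_eqVlt ltnS leqn0.
case/or3P=> [/cards2P[a [b [_ ->]]]|/cards1P[a ->]|].
- by right; exists a, b.
- by right; exists a, a; rewrite setUid.
- by rewrite cards_eq0 => /eqP; left.
Qed.

(** Stated on [nat] rather than on ['I_7] so that the finite check below reduces by plain
    computation. *)
Definition cycle7_rel : rel nat :=
  [rel i j | (j == i.+1 %% 7) || (i == j.+1 %% 7)].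

Lemma cycle7_sym : symmetric (fun i j : 'I_7 => cycle7_rel i j).
Proof. by move=> i j; exact: orbC. Qed.

Lemma cycle7_irrefl : irreflexive (fun i j : 'I_7 => cycle7_rel i j).
Proof. by case; do 7?[case=> //]. Qed.

Definition cycle7 : sgraph := SGraph cycle7_sym cycle7_irrefl.

Lemma cycle7_connected : connected cycle7.
Proof.
have con0 k : k < 7 -> connect (@edge cycle7) ord0 (inord k).
  elim: k => [|k IHk] lt_k7.
    by rewrite (_ : inord 0 = ord0) ?connect0 //; apply/val_inj; rewrite /= inordK.
  apply: connect_trans (IHk (ltnW lt_k7)) (connect1 _).
  (* The walk 0, 1, 2, ... stays below 7 and never takes the wrap-around edge. *)
  by rewrite /= /cycle7_rel /= !inordK ?(ltnW lt_k7) // modn_small // eqxx.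
have con0x (x : cycle7) : connect (@edge cycle7) ord0 x.
  by have := con0 x (ltn_ord x); rewrite inord_val.
move=> x y; apply: connect_trans (con0x y).
by rewrite (sym_connect_sym cycle7_sym).
Qed.

(* Sets of at most two vertices are encoded as [[::]] or [[:: a; b]], the
   singletons being the case [a = b]. *)
Definition cycle7_codes : seq (seq nat) :=
  [::] :: [seq [:: a; b] | a <- iota 0 7, b <- iota 0 7].

Definition cycle7_dominates (s : seq nat) (v : nat) : bool :=
  has (fun x => (v == x) || cycle7_rel x v) s.

(** Exhaustive check over all pairs of the 50 codes. The conclusion is [=i] because a set may have
    two codes, [[:: a; b]] and [[:: b; a]]. *)
Lemma cycle7_codes_identified :
  {in cycle7_codes &, forall s t,
    {in iota 0 7, cycle7_dominates s =1 cycle7_dominates t} -> s =i t}.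
Proof.
have chk : all (fun s => all (fun t =>
    all (fun v => cycle7_dominates s v == cycle7_dominates t v) (iota 0 7)
      ==> all (mem t) s && all (mem s) t) cycle7_codes) cycle7_codes.
  by vm_compute.
move=> s t /(allP chk)/allP st /st /implyP{}st dom_st.
have /andP[/allP sub_st /allP sub_ts] : all (mem t) s && all (mem s) t.
  by apply: st; apply/allP=> v v7; rewrite dom_st.
by move=> v; apply/idP/idP=> [/sub_st|/sub_ts].
Qed.

(** Transfers the computed check on lists of numbers to actual vertex sets of the cycle. *)
Lemma cycle7_codeP (X : {set cycle7}) : #|X| <= 2 ->
  exists2 s, s \in cycle7_codes &
    (forall v : cycle7, (v \in X) = (val v \in s)) /\
    (forall v : cycle7, (v \in closed_nbhd_set X) = cycle7_dominates s (val v)).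
Proof.
case/set_card_le2=> [->|[a [b ->]]].
  by exists [::] => //; split=> v; rewrite ?in_set0 // /closed_nbhd_set big_set0 inE.
exists [:: val a; val b].
  by rewrite inE; apply/orP; right; apply/allpairsP; exists (val a, val b);
     rewrite !mem_iota /= !ltn_ord.
split=> v; first by rewrite !inE.
by rewrite closed_nbhd_setU !closed_nbhd_set1 !inE /cycle7_dominates /= orbF.
Qed.

Lemma cycle7_Gr : Gr 7 7 2 cycle7.
Proof.
have card7 : #|cycle7| = 7 by rewrite card_ord.
split=> // C cardC X Y /eqP neqXY X2 Y2.
have -> : C = setT by apply/eqP; rewrite eqEcard subsetT cardsT cardC card7.
rewrite !setIT => /setP eqN; apply: neqXY; apply/setP=> v.
have [s s_code [memX domX]] := cycle7_codeP X2.
have [t t_code [memY domY]] := cycle7_codeP Y2.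
rewrite memX memY; apply: cycle7_codes_identified => // k.
rewrite mem_iota => /andP[_ lt_k7].
by have := eqN (Ordinal lt_k7 : cycle7); rewrite domX domY.
Qed.

Theorem theorem42 :
  smallest_from 2 (fun n => exists G : sgraph, Gr n n 2 G /\ connected G) 7
  /\ smallest_from 2
       (fun n => exists G : sgraph,
          Gr n n 2 G /\ ~ (exists x : G, isolated x)) 7.
Proof.
split; split=> //.
- by exists cycle7; split; [exact: cycle7_Gr | exact: cycle7_connected].
- move=> n n_ge2 [G [GrG conG]]; apply: (Gr_no_isolated_ge7 n_ge2 GrG).
  by apply: connected_no_isolated conG; case: GrG => ->.
- exists cycle7; split; first exact: cycle7_Gr.
  by apply: connected_no_isolated cycle7_connected; rewrite card_ord.
- by move=> n n_ge2 [G [GrG niso]]; apply: Gr_no_isolated_ge7 n_ge2 GrG niso.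
Qed.
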